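(* Fix $\epsilon>0$. In both the fixed data setting and the i.i.d. data setting the following holds: for any $\epsilon$-locally differentially private mechanism (for each number of users $N$, a private mechanism together with the aggregator's estimator $\tilde x$), there exists $F$ (which may depend on $N$; in the fixed data setting, together with users' data $x_1,\dots,x_N$ generated according to $F$) such that $\mathrm{Err}=\Omega(1)$ with respect to $N$, i.e. there are a constant $c>0$ and $N_0$ such that $\mathrm{Err}\ge c$ for all $N\ge N_0$.
   Context: There are $N\ge 2$ users; user $i$ holds $x_i\in[-1,1]$. Let $x_{(1)}\le\dots\le x_{(N)}$ be the ordered data. Data generation is described by a non-decreasing function $F:[-1,1]\to[0,1]$, and $x_{\min}=\inf\{x\in[-1,1]:F(x)>0\}$. Fixed data setting: the data are deterministic, with $F(x_{(i)})=(i-1)/(N-1)$ for all $i=1,\dots,N$, and $x_{\min}$ is the minimum of the data, $x_{(1)}=x_{\min}$. I.i.d. data setting: $F$ is a cumulative distribution function of a distribution supported on $[-1,1]$ and $x_1,\dots,x_N$ are drawn i.i.d. from it. Local differential privacy: let $\mathcal X=[-1,1]$ and let $\mathcal Z$ be a measurable space of messages with $\sigma$-field $\sigma(\mathcal Z)$; let $\mathcal Z^*$ be the set of finite sequences in $\mathcal Z$. A stochastic mechanism $\mathcal M$ from $\mathcal X\times\mathcal Z^*$ to $\mathcal Z$ is $\epsilon$-locally differentially private if for all $x,x'\in\mathcal X$, all $z\in\mathcal Z^*$ and all $S\in\sigma(\mathcal Z)$, $\Pr\{\mathcal M(x,z)\in S\}\le e^{\epsilon}\Pr\{\mathcal M(x',z)\in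 S\}$. User $i$ sends $Z_i=\mathcal M(x_i,(Z_1,\dots,Z_{i-1}))$ to the aggregator, where the second argument is the sanitized data already revealed, and the aggregator outputs an estimate $\tilde x$ computed from $(Z_1,\dots,Z_N)$ only. Error: $\mathrm{Err}=\mathbb E\big[|x_{\min}-\tilde x|\big]$, the expectation being over the randomness of the mechanism and, in the i.i.d. setting, of the data. *)

(* Defs.v *)
From HB Require Import structures.
From mathcomp Require Import all_boot all_order all_algebra.
From mathcomp Require Import all_classical all_reals all_analysis.
From mathcomp Require Import measurable_realfun.

Set Implicit Arguments.
Unset Strict Implicit.
Unset Printing Implicit Defensive.

Import Order.TTheory GRing.Theory Num.Theory.

Local Open Scope classical_set_scope.
Local Open Scope ring_scope.
Local Open Scope ereal_scope.

(* [-1, 1], with the trace of the Borel sigma-field. *)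
Definition datum (R : realType) := {x : R | (-1 <= x <= 1)%R}.

Definition datum_val (R : realType) : datum R -> R := \val.

Section datum.
Variable R : realType.

Let datum0 : datum R.
Proof. by exists 0%R; rewrite lerN10 ler01. Defined.

HB.instance Definition _ := Choice.on (datum R).
HB.instance Definition _ := isPointed.Build (datum R) datum0.

Definition datum_sets : set (set (datum R)) :=
  preimage_set_system setT (@datum_val R) measurable.

HB.instance Definition _ :=
  Measurable.copy (datum R) (g_sigma_algebraType datum_sets).

Lemma measurable_datum_val : measurable_fun setT (@datum_val R).
Proof.
by move=> _ Y mY; rewrite setTI; apply: sub_sigma_algebra; exists Y;
  rewrite ?setTI.
Qed.

HB.instance Definition _ :=
  isMeasurableFun.Build _ _ _ _ (@datum_val R) measurable_datum_val.

End datum.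

Section ksection.
Context d0 d1 d2 (T0 : measurableType d0) (T1 : measurableType d1)
  (T2 : measurableType d2) (R : realType) (k : R.-pker (T0 * T1) ~> T2).

Definition ksection (x : T0) (y : T1) : {measure set T2 -> \bar R} := k (x, y).

Let measurable_ksection x U : measurable U ->
  measurable_fun [set: T1] (ksection x ^~ U).
Proof.
move=> mU.
exact: measurableT_comp (measurable_kernel k _ mU) _.
Qed.

HB.instance Definition _ x :=
  isKernel.Build _ _ _ _ _ (ksection x) (@measurable_ksection x).

Let ksection_setT x y : ksection x y setT = 1.
Proof. exact: prob_kernel. Qed.

HB.instance Definition _ x :=
  Kernel_isProbability.Build _ _ _ _ _ (ksection x) (ksection_setT x).

End ksection.

Section seq_law.
Context d (T : measurableType d) (R : realType).

(* The law of (z, y), as an (n+1)-tuple, when z has law P and y has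
   conditional law k z given z. *)
Definition law_rcons n (k : R.-pker (n.-tuple T) ~> T)
    (P : probability (n.-tuple T) R) (A : set (n.+1.-tuple T)) : \bar R :=
  \int[P]_z k z [set y | A [tuple of rcons z y]].

Section law_rcons.
Variables (n : nat) (k : R.-pker (n.-tuple T) ~> T).
Variable P : probability (n.-tuple T) R.

Lemma measurable_rcons :
  measurable_fun setT
    (fun zy : n.-tuple T * T => [tuple of rcons zy.1 zy.2] : n.+1.-tuple T).
Proof.
apply/measurable_fun_tnthP => i.
have [ilt|ige] := ltnP i n.
- rewrite (_ : _ \o _ = (@tnth n T ^~ (Ordinal ilt)) \o fst).
    by apply: measurableT_comp => //; exact: measurable_tnth.
  by apply/funext => -[z y] /=; rewrite !(tnth_nth y)/= nth_rcons size_tuple ilt.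
- rewrite (_ : _ \o _ = snd) //.
  have iE : i = n :> nat by apply/eqP; rewrite eqn_leq ige -ltnS ltn_ord.
  apply/funext => -[z y] /=.
  by rewrite (tnth_nth y)/= nth_rcons size_tuple iE ltnn eqxx.
Qed.

Lemma measurable_rcons_section (A : set (n.+1.-tuple T)) (z : n.-tuple T) :
  measurable A -> measurable [set y | A [tuple of rcons z y]].
Proof.
move=> mA; have := @measurable_fun_pair2 _ _ _ _ _ _ _ z measurable_rcons.
by move=> /(_ measurableT A mA); rewrite setTI.
Qed.

Lemma measurable_law_rcons_integrand (A : set (n.+1.-tuple T)) : measurable A ->
  measurable_fun setT (fun z => k z [set y | A [tuple of rcons z y]]).
Proof.
move=> mA.
have mB : measurable
    ((fun zy : n.-tuple T * T => [tuple of rcons zy.1 zy.2]) @^-1` A).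
  by rewrite -[X in measurable X]setTI; exact: measurable_rcons.
have := measurable_fun_xsection_finite_kernel k (mem_set mB).
by under eq_fun do rewrite xsectionE.
Qed.

Let law_rcons0 : law_rcons k P set0 = 0.
Proof.
by apply: integral0_eq => z _; rewrite (_ : [set _ | _] = set0) ?measure0.
Qed.

Let law_rcons_ge0 A : 0 <= law_rcons k P A.
Proof. exact: integral_ge0. Qed.

Let law_rcons_sigma_additive : semi_sigma_additive (law_rcons k P).
Proof.
move=> A mA tA mUA; rewrite [X in _ --> X](_ : _ =
    \int[P]_z \sum_(i <oo) k z [set y | A i [tuple of rcons z y]]); last first.
  apply: eq_integral => z _; apply/esym/cvg_lim => //.
  rewrite (_ : [set _ | _] = \bigcup_i [set y | A i [tuple of rcons z y]])//.
  apply: measure_semi_sigma_additive.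
  - by move=> i; exact: measurable_rcons_section.
  - by apply/trivIsetP => i j _ _ ij; move/trivIsetP : tA => /(_ i j I I ij);
      rewrite -!subset0 => + y => /(_ [tuple of rcons z y]).
  - exact: (measurable_rcons_section z mUA).
apply/cvg_closeP; split.
  by apply: is_cvg_nneseries => i _ _; exact: integral_ge0.
by rewrite closeE// integral_nneseries// => i;
  exact: measurable_law_rcons_integrand.
Qed.

HB.instance Definition _ := isMeasure.Build _ _ R (law_rcons k P)
  law_rcons0 law_rcons_ge0 law_rcons_sigma_additive.

Let law_rconsT : law_rcons k P setT = 1.
Proof.
rewrite /law_rcons (eq_integral (cst 1)) => [|z _]; last exact: prob_kernel.
by rewrite integral_cst// mul1e; exact: probability_setT.
Qed.

HB.instance Definition _ :=
  Measure_isProbability.Build _ _ _ (law_rcons k P) law_rconsT.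

End law_rcons.

(* The law of (Y_1, ..., Y_n) when the conditional law of Y_(i+1) given
   (Y_1, ..., Y_i) is k i. *)
Fixpoint seq_law (k : forall n, R.-pker (n.-tuple T) ~> T) (n : nat) :
    probability (n.-tuple T) R :=
  match n with
  | 0%N => \d_[tuple]
  | n'.+1 => law_rcons (k n') (seq_law k n')
  end.

End seq_law.

Section iid.
Context d (T : measurableType d) (R : realType) (mu : probability T R).

Definition kconst n (_ : n.-tuple T) : {measure set T -> \bar R} := mu.

Let measurable_kconst n U : measurable U ->
  measurable_fun setT (@kconst n ^~ U).
Proof. by move=> mU; exact: measurable_cst. Qed.

HB.instance Definition _ n :=
  isKernel.Build _ _ _ _ _ (@kconst n) (@measurable_kconst n).

Let kconst_setT n z : @kconst n z setT = 1.
Proof. exact: probability_setT. Qed.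

HB.instance Definition _ n :=
  Kernel_isProbability.Build _ _ _ _ _ (@kconst n) (@kconst_setT n).

Definition iid_law (n : nat) : probability (n.-tuple T) R :=
  seq_law (fun i => @kconst i) n.

End iid.

Section local_privacy.
Context d (Z : measurableType d) (R : realType).

(* A Markov kernel from [-1, 1] x Z^* to Z, the set Z^* of finite sequences
   being the disjoint union over k of the spaces Z^k. *)
Definition mechanism := forall k : nat, R.-pker (datum R * k.-tuple Z) ~> Z.

Definition locally_private (eps : R) (M : mechanism) : Prop :=
  forall (k : nat) (z : k.-tuple Z) (x x' : datum R) (S : set Z),
    measurable S -> M k (x, z) S <= (expR eps)%:E * M k (x', z) S.

(* The law of the messages (Z_1, ..., Z_N) when the users hold x: given the
   first i messages, the next one has law M i (x_(i+1), -). Only i < N occurs,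
   so the default of nth is never reached. *)
Definition messages_law (M : mechanism) (N : nat) (x : N.-tuple (datum R)) :
    probability (N.-tuple Z) R :=
  seq_law (fun i => ksection (M i) (nth point x i)) N.

End local_privacy.

Section data_generation.
Context (R : realType).
Local Open Scope ring_scope.

Definition is_generator (F : datum R -> R) : Prop :=
  (forall x y, datum_val x <= datum_val y -> F x <= F y) /\
  (forall x, 0 <= F x <= 1).

Definition xmin (F : datum R -> R) : R :=
  inf [set datum_val x | x in [set x | 0 < F x]].

Definition ordered (N : nat) (x : N.-tuple (datum R)) : seq (datum R) :=
  sort (fun a b => datum_val a <= datum_val b) x.

(* Ranks are counted from 0, so the right-hand side is (rank - 1) / (N - 1) in
   1-based ranks; meant for N >= 2. *)
Definition fixed_data (N : nat) (F : datum R -> R) (x : N.-tuple (datum R)) :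
    Prop :=
  [/\ is_generator F,
      forall i, (i < N)%N -> F (nth point (ordered x) i) = i%:R / N.-1%:R &
      datum_val (nth point (ordered x) 0) = xmin F].

(* A probability on datum R is a distribution supported on [-1, 1]. *)
Definition iid_data (F : datum R -> R) (mu : probability (datum R) R) : Prop :=
  is_generator F /\
  forall x, (F x)%:E = cdf (@datum_val R : {RV mu >-> R}) (datum_val x).

End data_generation.

Section error.
Context d (Z : measurableType d) (R : realType).
Variables (M : mechanism Z R) (N : nat) (est : N.-tuple Z -> R).

Definition err_fixed (F : datum R -> R) (x : N.-tuple (datum R)) : \bar R :=
  'E_(messages_law M x) [fun z => `|xmin F - est z|%R].

(* The messages have law messages_law M x conditionally on the data x. *)
Definition err_iid (F : datum R -> R) (mu : probability (datum R) R) : \bar R :=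
  \int[iid_law mu N]_x err_fixed F x.

End error.

(* e N = Omega(1) as N goes to infinity. *)
Definition Omega1 (R : realType) (e : nat -> \bar R) : Prop :=
  exists2 c : R, (0 < c)%R &
    exists N0 : nat, forall N, (N0 <= N)%N -> c%:E <= e N.

(* Main.v *)
Require Import Defs.
From HB Require Import structures.
From mathcomp Require Import all_boot all_order all_algebra.
From mathcomp Require Import all_classical all_reals all_analysis.
From mathcomp Require Import measurable_realfun.
From mathcomp Require Import lra.

(** The minimum of the data may be carried by a single user, and the aggregator
    cannot see a single user. This is Le Cam's two-point method: two possible
    values of [xmin], -1 and 0, together with two laws of the messages that are
    comparable up to a constant factor independent of N. Under any one law P of
    the messages, the triangle inequality gives
      1 <= E_P |-1 - est| + E_P |0 - est|
    ([dist_le_two_point_risk]), so the estimator fails for one of the two values.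

    With fixed data, N - 1 users hold the points k / (N - 1), 1 <= k <= N - 1,
    and the last user holds y, which is -1 or 0. Since y is below all the other
    data, it is [xmin]. The two data sets differ in the last user only, so eps-local
    privacy says directly that the laws of the messages are within a factor
    e^eps of each other ([messages_law_private]), no composition over the users
    being involved. Hence e^eps Err(-1) + Err(0) >= 1, and one of the two
    errors is at least 1 / (1 + e^eps).

    With i.i.d. data, compare the point mass at 0, for which [xmin] is 0, with
    (1 - p) delta_0 + p delta_(-1), for which [xmin] is -1. When p = 1 / (2 N),
    all N data equal 0 with probability at least 1 / 2 under the second law too,
    in which case the messages have the same law as under the first. The error is
    therefore at least 1 / 4 for one of the two. *)

Set Implicit Arguments.
Unset Strict Implicit.
Unset Printing Implicit Defensive.

Import Order.TTheory GRing.Theory Num.Theory.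

Local Open Scope classical_set_scope.
Local Open Scope ereal_scope.
Local Open Scope ring_scope.

(** * Integral inequalities *)

Section integral_bounds.
Context d (T : measurableType d) (R : realType).
Local Open Scope ereal_scope.
Import HBNNSimple.

(** The integral of a nonnegative function is a supremum over the simple
    functions below it, and [c] times the indicator of [A] is one of them. As
    this is true of any [f], the lemma bounds [err_iid] below without a proof
    that the error is measurable in the data. *)
Lemma integral_ge_cst_on (mu : {measure set T -> \bar R}) (f : T -> \bar R)
    (A : set T) (c : R) :
  measurable A -> (0 <= c)%R -> (forall x, 0 <= f x) ->
  (forall x, A x -> c%:E <= f x) -> c%:E * mu A <= \int[mu]_x f x.
Proof.
move=> mA c0 f0 cf; rewrite ge0_integralTE// -sintegral_indic.
rewrite -(sintegralrM mu c (indic_nnsfun R mA)).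
apply: ereal_sup_ubound => /=.
exists (scale_nnsfun (indic_nnsfun R mA) c0) => //= x.
rewrite /indic_nnsfun /= /mindic indicE.
case: (boolP (x \in A)) => [/set_mem Ax|_].
  by rewrite mulr1; exact: cf.
by rewrite mulr0; exact: f0.
Qed.

Lemma ge0_integral_le_scale (m1 m2 : {measure set T -> \bar R}) (k : R)
    (f : T -> \bar R) :
  (0 <= k)%R -> (forall A, measurable A -> m1 A <= k%:E * m2 A) ->
  (forall x, 0 <= f x) -> measurable_fun setT f ->
  \int[m1]_x f x <= k%:E * \int[m2]_x f x.
Proof.
move=> k0 m12 f0 mf; rewrite -(ge0_integral_mscale m2 measurableT (NngNum k0))//.
exact: ge0_le_measure_integral.
Qed.

(** The estimation step of Le Cam's two-point method: no [g] is close to both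
    [a] and [b] under the same law. *)
Lemma dist_le_two_point_risk (P : probability T R) (g : T -> R) (a b : R) :
  measurable_fun setT g ->
  `|a - b|%:E <= \int[P]_z `|a - g z|%:E + \int[P]_z `|b - g z|%:E.
Proof.
move=> mg.
have mdist (c : R) : measurable_fun setT (fun z => `|c - g z|%:E).
  by apply/measurable_EFinP/measurableT_comp => //; exact: measurable_funB.
rewrite -ge0_integralD//=.
rewrite -[leLHS]mule1 -(probability_setT P) -integral_cst//.
apply: ge0_le_integral => //=.
  exact: emeasurable_funD.
move=> z _; rewrite -EFinD lee_fin.
by rewrite (distrC b (g z)); exact: ler_distD.
Qed.

End integral_bounds.

(** * Fixed data *)

Section fixed_data_setting.
Context (R : realType).

(** The [insubd] default is never reached: (i + 1) / n is in [0, 1] for i < n. *)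
Definition ladder n : n.-tuple (datum R) :=
  [tuple insubd (point : datum R) (i.+1%:R / n%:R) | i < n].

(** On the points of [ladder n], which are at least 1 / n, this is the identity,
    and (i + 1) / n is the value required at rank i + 1 among n + 1 data. The
    jump from 0 to 1 / n just above [y] makes [y] the infimum of
    the points where this is positive. *)
Definition ladder_generator n (y v : datum R) : R :=
  if datum_val v <= datum_val y then 0 else Num.max (datum_val v) n%:R^-1.

Lemma ladder_val n i : (i < n)%N ->
  datum_val (nth point (ladder n) i) = i.+1%:R / n%:R.
Proof.
move=> ltin; rewrite -[i]/(val (Ordinal ltin)) -tnth_nth tnth_mktuple.
rewrite /datum_val val_insubd ifT//=.
have n0 : 0 < n%:R :> R by rewrite ltr0n (leq_trans _ ltin).
apply/andP; split.
  by rewrite (@le_trans _ _ 0) ?lerN10// divr_ge0.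
by rewrite ler_pdivrMr// mul1r ler_nat.
Qed.

Lemma xmin_ladder_generator n (y : datum R) : (0 < n)%N -> datum_val y < 1 ->
  xmin (ladder_generator n y) = datum_val y.
Proof.
move=> n0 y1; rewrite /xmin -[RHS](@inf_itv R (BRight 1) false (datum_val y))//.
congr inf; apply/seteqP; split => [_ [x /= Fx <-]|v /=].
  rewrite in_itv/=; have /andP[_ ->] := valP x; rewrite andbT ltNge.
  by apply/negP => xy; move: Fx; rewrite /ladder_generator xy ltxx.
rewrite in_itv/= => /andP[yv v1].
have vP : -1 <= v <= 1.
  by rewrite v1 (le_trans _ (ltW yv))//; have /andP[] := valP y.
exists (Sub v vP : datum R) => //=.
by rewrite /ladder_generator leNgt yv/= lt_max orbC invr_gt0 ltr0n n0.
Qed.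

Lemma fixed_data_ladder n (y : datum R) : (0 < n)%N -> datum_val y <= 0 ->
  fixed_data (ladder_generator n y) [tuple of rcons (ladder n) y].
Proof.
move=> n0 y0.
have nR0 : 0 < n%:R :> R by rewrite ltr0n.
pose le (a b : datum R) := datum_val a <= datum_val b.
have le_tr : transitive le by move=> b a c; exact: le_trans.
have le_tot : total le by move=> a b; exact: le_total.
have le_anti : antisymmetric le.
  by move=> a b; rewrite /le => /le_anti /val_inj.
have ladder_gt i : (i < n)%N -> datum_val y < datum_val (nth point (ladder n) i).
  by move=> ltin; rewrite ladder_val// (le_lt_trans y0)// divr_gt0.
have ordE : ordered [tuple of rcons (ladder n) y] = y :: ladder n :> seq _.
  rewrite /ordered -/le.
  have /(perm_sortP le_tot le_tr le_anti) -> :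
    perm_eq (rcons (ladder n) y) (y :: ladder n) by rewrite perm_rcons.
  apply: sorted_sort => //; apply/(sortedP point) => -[|i].
    by rewrite /= size_tuple card_ord ltnS => ltin; exact/ltW/ladder_gt.
  rewrite /= size_tuple card_ord ltnS => ltin.
  by rewrite /le !ladder_val// 1?ltnW// ler_pM2r ?invr_gt0// ler_nat.
have nV0 : 0 <= n%:R^-1 :> R by rewrite invr_ge0 ltW.
have nV1 : n%:R^-1 <= 1 :> R by rewrite invf_le1// (ler_nat _ 1).
split; last by rewrite ordE xmin_ladder_generator// (le_lt_trans y0).
- split=> [u v uv|v]; rewrite /ladder_generator.
    case: ifPn => [_|]; first by case: ifPn; rewrite // le_max nV0 orbT.
    rewrite -ltNge => yu; rewrite [datum_val v <= _]leNgt (lt_le_trans yu uv)/=.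
    by rewrite ge_max !le_max uv lexx orbT.
  case: ifPn => _; first by rewrite lexx ler01.
  rewrite le_max nV0 orbT/= ge_max nV1 andbT.
  by have /andP[] := valP v.
- move=> [_|i]; first by rewrite ordE/= /ladder_generator lexx mul0r.
  rewrite ltnS ordE/= /ladder_generator => ltin.
  rewrite leNgt ladder_gt//= ladder_val//; apply/max_idPl.
  by rewrite -[leLHS]mul1r ler_pM2r ?invr_gt0// (ler_nat _ 1).
Qed.

(** The message of the last user influences no other message, so the other ones
    have the law that they would have without this user. *)
Lemma messages_law_rcons d (Z : measurableType d) (M : mechanism Z R) n
    (s : n.-tuple (datum R)) (y : datum R) :
  messages_law M [tuple of rcons s y] =
  law_rcons (ksection (M n) y) (messages_law M s).
Proof.
rewrite /messages_law /= nth_rcons size_tuple ltnn eqxx; congr law_rcons.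
suff E m : (m <= n)%N ->
    seq_law (fun i => ksection (M i) (nth point (rcons s y) i)) m =
    seq_law (fun i => ksection (M i) (nth point s i)) m by exact: E.
elim: m => //= m IHm ltmn.
by rewrite (IHm (ltnW ltmn)) nth_rcons size_tuple ltmn.
Qed.

Lemma law_rcons_le_scale d (T : measurableType d) n
    (k k' : R.-pker (n.-tuple T) ~> T) (P : probability (n.-tuple T) R) (c : R)
    (A : set (n.+1.-tuple T)) :
  0 <= c -> (forall z B, measurable B -> k z B <= c%:E * k' z B)%E ->
  measurable A -> (law_rcons k P A <= c%:E * law_rcons k' P A)%E.
Proof.
move=> c0 kk' mA; rewrite /law_rcons.
rewrite -ge0_integralZl//; last exact: measurable_law_rcons_integrand.
apply: ge0_le_integral => //.
- exact: measurable_law_rcons_integrand.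
- by apply: measurable_funeM; exact: measurable_law_rcons_integrand.
- by move=> z _; apply: kk'; exact: measurable_rcons_section.
Qed.

(** Varying the data of the last user costs a single factor e^eps on the joint
    law of all the messages: only the last conditional law changes. *)
Lemma messages_law_private d (Z : measurableType d) (M : mechanism Z R)
    (eps : R) n (s : n.-tuple (datum R)) (y y' : datum R)
    (A : set (n.+1.-tuple Z)) :
  locally_private eps M -> measurable A ->
  (messages_law M [tuple of rcons s y] A <=
   (expR eps)%:E * messages_law M [tuple of rcons s y'] A)%E.
Proof.
move=> M_private mA; rewrite !messages_law_rcons.
apply: law_rcons_le_scale => //.
by move=> z B mB; exact: M_private.
Qed.

Lemma err_fixedE d (Z : measurableType d) (M : mechanism Z R) n
    (est : n.-tuple Z -> R) (F : datum R -> R) (x : n.-tuple (datum R)) :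
  (err_fixed M est F x =
   \int[messages_law M x]_z `|xmin F - est z|%:E)%E.
Proof. by rewrite /err_fixed unlock. Qed.

(** Both risks are compared under the law of the messages for [y'], at the price
    of the privacy factor on the risk for [y]. *)
Lemma fixed_risk_tradeoff d (Z : measurableType d) (M : mechanism Z R)
    (eps : R) n (est : {mfun n.+1.-tuple Z >-> R}) (y y' : datum R) :
  locally_private eps M -> (0 < n)%N -> datum_val y <= 0 -> datum_val y' <= 0 ->
  (`|datum_val y - datum_val y'|%:E <=
   (expR eps)%:E * err_fixed M est (ladder_generator n y)
                     [tuple of rcons (ladder n) y] +
   err_fixed M est (ladder_generator n y') [tuple of rcons (ladder n) y'])%E.
Proof.
move=> M_private n0 y0 y'0; rewrite !err_fixedE.
rewrite !xmin_ladder_generator ?(le_lt_trans _ ltr01)//.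
apply: le_trans (dist_le_two_point_risk
  (messages_law M [tuple of rcons (ladder n) y']) _ _ (measurable_funPT est)) _.
rewrite leeD2r//; apply: ge0_integral_le_scale => //.
- by move=> A mA; exact: messages_law_private.
- apply/measurable_EFinP/measurableT_comp => //; exact: measurable_funB.
Qed.

Lemma exists_hard_fixed_data d (Z : measurableType d) (M : mechanism Z R)
    (eps : R) n (est : {mfun n.+1.-tuple Z >-> R}) :
  locally_private eps M -> (0 < n)%N ->
  exists F (x : n.+1.-tuple (datum R)),
    fixed_data F x /\ ((1 + expR eps)^-1%:E <= err_fixed M est F x)%E.
Proof.
move=> M_private n0.
have m1P : -1 <= (-1 : R) <= 1 by lra.
have z1P : -1 <= (0 : R) <= 1 by lra.
pose y : datum R := Sub (-1) m1P; pose y' : datum R := Sub 0 z1P.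
have y0 : datum_val y <= 0 by rewrite /datum_val/= lerN10.
have y'0 : datum_val y' <= 0 by rewrite /datum_val/=.
have := fixed_risk_tradeoff est M_private n0 y0 y'0.
set x := [tuple of rcons _ y]; set x' := [tuple of rcons _ y'].
set F := ladder_generator n y; set F' := ladder_generator n y'.
rewrite subr0 normrN1 => H.
have [h|h] := leP (1 + expR eps)^-1%:E (err_fixed M est F x).
  by exists F, x; split=> //; exact: fixed_data_ladder.
exists F', x'; split; first exact: fixed_data_ladder.
rewrite leNgt; apply/negP => h'; move: H; apply/negP; rewrite -ltNge.
have e0 := expR_gt0 eps.
have -> : 1%:E = ((expR eps)%:E * (1 + expR eps)^-1%:E + (1 + expR eps)^-1%:E)%E.
  rewrite -EFinM -EFinD; congr EFin.
  by rewrite addrC -{1}[_^-1]mul1r -mulrDl divff// gt_eqF// addr_gt0.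
by rewrite lteD// lte_pmul2l// lte_fin.
Qed.

End fixed_data_setting.

(** * I.i.d. data *)

Section iid_setting.
Context (R : realType).

Lemma measurable_datum1 (x : datum R) : measurable [set x].
Proof.
rewrite (_ : [set x] = @datum_val R @^-1` [set datum_val x]).
  by rewrite -[X in measurable X]setTI; exact: measurable_datum_val.
by apply/seteqP; split => [_ ->|y /= /val_inj].
Qed.

Lemma measurable_tuple_cst n (x : datum R) :
  measurable [set [tuple of nseq n x]].
Proof.
rewrite (_ : [set _] =
    \bigcap_(i in [set: 'I_n])
      (fun t : n.-tuple (datum R) => tnth t i) @^-1` [set x]); last first.
  apply/seteqP; split => [_ -> i _ /=|t tP /=]; first by rewrite tnth_nseq.
  by apply: eq_from_tnth => i; rewrite tnth_nseq; exact: tP.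
apply: fin_bigcap_measurable => // i _.
rewrite -[X in measurable X]setTI; apply: measurable_tnth => //.
exact: measurable_datum1.
Qed.

Lemma iid_law_cst (mu : probability (datum R) R) n (x : datum R) (q : R) :
  0 <= q -> (q%:E <= mu [set x])%E ->
  ((q ^+ n)%:E <= iid_law mu n [set [tuple of nseq n x]])%E.
Proof.
move=> q0 qmu; elim: n => [|n IHn].
  by rewrite expr0 /iid_law /= diracE mem_set//=; apply: val_inj.
rewrite /iid_law /= /law_rcons.
rewrite exprS EFinM; apply: le_trans (lee_wpmul2l _ IHn) _ => //.
apply: integral_ge_cst_on => //; first exact: measurable_tuple_cst.
move=> _ /= ->; rewrite /kconst (_ : [set _ | _] = [set x])//.
have nseqSr : nseq n.+1 x = rcons (nseq n x) x.
  by rewrite -cats1 -[[:: x]]/(nseq 1 x) -nseqD addn1.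
apply/seteqP; split => [y /= /(congr1 val)|_ /= ->]; last exact: val_inj.
by rewrite [RHS]nseqSr => /rcons_inj [].
Qed.

Lemma iid_data_cdf (mu : probability (datum R) R) :
  iid_data (fun x => fine (cdf (@datum_val R : {RV mu >-> R}) (datum_val x))) mu.
Proof.
have fin (r : R) : cdf (@datum_val R : {RV mu >-> R}) r \is a fin_num.
  exact: fin_num_measure.
split=> [|x]; last by rewrite fineK.
split=> [x y xy|x]; first by rewrite fine_le ?fin// cdf_nondecreasing.
by rewrite fine_ge0//= -lee_fin fineK// cdf_le1.
Qed.

Lemma iid_data_xmin (F : datum R -> R) (mu : probability (datum R) R)
    (a : datum R) :
  iid_data F mu -> (0 < mu [set a])%E ->
  mu [set x | datum_val x < datum_val a] = 0%E -> xmin F = datum_val a.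
Proof.
move=> [_ FE] mua mu0.
have m_itv (i : interval R) : measurable (@datum_val R @^-1` [set` i]).
  rewrite -[X in measurable X]setTI.
  by apply: measurable_datum_val => //; exact: measurable_itv.
have Fa : 0 < F a.
  rewrite -lte_fin FE; apply: lt_le_trans mua _.
  apply: le_measure; rewrite ?inE; [exact: measurable_datum1|exact: m_itv|].
  by move=> _ ->; rewrite /= in_itv/=.
rewrite /xmin; apply/le_anti/andP; split.
  apply: ge_inf; last by exists a.
  by exists (-1) => _ [x _ <-]; have /andP[] := valP x.
apply: lb_le_inf; first by exists (datum_val a), a.
move=> _ [x /= Fx <-]; rewrite leNgt; apply/negP => xa.
move: Fx; rewrite -lte_fin FE ltNge => /negP; apply.
rewrite -[leRHS]mu0.
apply: (@le_measure _ _ _ mu); rewrite ?inE; first exact: m_itv.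
  rewrite (_ : [set _ | _] = @datum_val R @^-1` [set` `]-oo, datum_val a[]).
    exact: m_itv.
  by apply/seteqP; split => v /=; rewrite in_itv.
by move=> v /=; rewrite in_itv/= => /le_lt_trans; exact.
Qed.

(** The integral over the data is bounded below by the contribution of the event
    that all the data equal [x]. *)
Lemma err_iid_ge d (Z : measurableType d) (M : mechanism Z R) n
    (est : n.-tuple Z -> R) (F : datum R -> R) (mu : probability (datum R) R)
    (x : datum R) (c q : R) :
  0 <= c -> 0 <= q -> (q%:E <= mu [set x])%E ->
  (c%:E <= err_fixed M est F [tuple of nseq n x])%E ->
  ((c * q ^+ n)%:E <= err_iid M est F mu)%E.
Proof.
move=> c0 q0 qmu cerr; rewrite EFinM.
apply: le_trans (lee_wpmul2l _ (iid_law_cst n q0 qmu)) _ => //.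
apply: integral_ge_cst_on => //; first exact: measurable_tuple_cst.
- by move=> t; rewrite err_fixedE; exact: integral_ge0.
- by move=> _ ->.
Qed.

Definition datum_if (x y : datum R) (b : bool) : datum R := if b then x else y.

Lemma measurable_datum_if x y : measurable_fun setT (datum_if x y).
Proof. by []. Qed.

HB.instance Definition _ x y :=
  isMeasurableFun.Build _ _ _ _ (datum_if x y) (measurable_datum_if x y).

Definition two_atoms (p : R) (x y : datum R) : probability (datum R) R :=
  distribution (bernoulli_prob p) (datum_if x y).

Lemma two_atomsE (p : R) (x y : datum R) (A : set (datum R)) : 0 <= p <= 1 ->
  two_atoms p x y A = (p%:E * \d_x A + (1 - p)%:E * \d_y A)%E.
Proof.
by move=> p01; rewrite /two_atoms/= /distribution /pushforward bernoulli_probE.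
Qed.

Lemma bernoulli_inequality (p : R) n : 0 <= p <= 1 ->
  1 - n%:R * p <= (1 - p) ^+ n.
Proof.
move=> /andP[p0 p1]; elim: n => [|n IHn]; first by rewrite mul0r subr0 expr0.
have q0 : 0 <= 1 - p by rewrite subr_ge0.
rewrite exprS; apply: le_trans (ler_wpM2l q0 IHn).
have : 0 <= n%:R * p ^+ 2 by rewrite mulr_ge0// sqr_ge0.
by rewrite -natr1; nra.
Qed.

Lemma exists_hard_iid_data d (Z : measurableType d) (M : mechanism Z R) n
    (est : {mfun n.-tuple Z >-> R}) : (0 < n)%N ->
  exists F mu, iid_data F mu /\ (4^-1%:E <= err_iid M est F mu)%E.
Proof.
move=> n0.
have m1P : -1 <= (-1 : R) <= 1 by lra.
have z1P : -1 <= (0 : R) <= 1 by lra.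
pose y : datum R := Sub (-1) m1P; pose z : datum R := Sub 0 z1P.
have y_neq_z : y != z by rewrite -val_eqE/= oppr_eq0 oner_eq0.
have nR1 : 1 <= n%:R :> R by rewrite (ler_nat _ 1).
have nR0 : 0 < n%:R :> R by rewrite ltr0n.
pose F p x :=
  fine (cdf (@datum_val R : {RV two_atoms p y z >-> R}) (datum_val x)).
have data p : iid_data (F p) (two_atoms p y z) by exact: iid_data_cdf.
(* Whatever [p] at most 1 / (2 n), all the data are 0 with probability at
   least 1 / 2, so a large error on the data set (0, ..., 0) suffices. *)
have hard p : 0 <= p -> p < 1 -> n%:R * p <= 2^-1 ->
    (2^-1%:E <= err_fixed M est (F p) [tuple of nseq n z])%E ->
    (4^-1%:E <= err_iid M est (F p) (two_atoms p y z))%E.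
  move=> p0 p1 np err.
  have p01 : 0 <= p <= 1 by rewrite p0 ltW.
  have c0 : 0 <= 2^-1 :> R by [].
  have q0 : 0 <= 1 - p by lra.
  apply: le_trans (err_iid_ge c0 q0 _ err); last first.
    rewrite two_atomsE// !diracE memNset ?mem_set//=; last exact/eqP.
    by rewrite mule0 mule1 add0e.
  rewrite lee_fin; have := bernoulli_inequality n p01.
  set u := _ ^+ _; lra.
(* On that data set, the law of the messages is the same for all [p]. The estimator
   is either far from -1, and bad for p = 1 / (2 n), or far from 0, and bad
   for p = 0. *)
have [h|h] := leP (2^-1%:E)
    (\int[messages_law M [tuple of nseq n z]]_t `|datum_val y - est t|%:E)%E.
  pose p : R := (2 * n%:R)^-1.
  have p0 : 0 < p by rewrite invr_gt0 mulr_gt0.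
  have p1 : p < 1 by rewrite invf_lt1 ?mulr_gt0//; lra.
  exists (F p), (two_atoms p y z); split => //; apply: hard => //.
  - exact: ltW.
  - by rewrite /p invfM mulrCA divff ?mulr1// gt_eqF.
  - rewrite err_fixedE (iid_data_xmin (a := y) (data p))//.
      rewrite two_atomsE ?(ltW p0) ?(ltW p1)// !diracE mem_set// memNset; last first.
        by move=> /= zy; move: y_neq_z; rewrite zy eqxx.
      by rewrite mule0 mule1 adde0 lte_fin.
    rewrite two_atomsE ?(ltW p0) ?(ltW p1)// !diracE !memNset ?mule0 ?adde0//=.
      by rewrite /datum_val/=; apply/negP; rewrite -leNgt; lra.
    by rewrite ltxx.
have p01 : 0 <= (0 : R) <= 1 by lra.
exists (F 0), (two_atoms 0 y z); split => //; apply: hard; rewrite ?mulr0//.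
rewrite err_fixedE (iid_data_xmin (a := z) (data 0)); last 2 first.
- by rewrite two_atomsE// !diracE (@mem_set _ _ z)// mul0e add0e mule1 subr0.
- rewrite two_atomsE// mul0e add0e diracE memNset ?mule0//=.
  by rewrite ltxx.
rewrite leNgt; apply/negP => h'.
have := dist_le_two_point_risk (messages_law M [tuple of nseq n z])
  (datum_val y) (datum_val z) (measurable_funPT est).
apply/negP; rewrite -ltNge (lt_le_trans (lteD h h'))//.
rewrite -EFinD lee_fin /datum_val/= subr0 normrN1; lra.
Qed.

End iid_setting.

Theorem theorem1 (R : realType) (eps : R) (eps_gt0 : 0 < eps)
    (d : nat -> measure_display) (Z : forall N : nat, measurableType (d N))
    (M : forall N : nat, mechanism (Z N) R)
    (xtilde : forall N : nat, {mfun N.-tuple (Z N) >-> R})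
    (M_private : forall N : nat, (2 <= N)%N -> locally_private eps (M N)) :
  (exists (F : nat -> datum R -> R) (x : forall N : nat, N.-tuple (datum R)),
     (forall N : nat, (2 <= N)%N -> fixed_data (F N) (x N)) /\
     Omega1 (fun N => err_fixed (M N) (xtilde N) (F N) (x N)))
  /\
  (exists (F : nat -> datum R -> R) (mu : nat -> probability (datum R) R),
     (forall N : nat, (2 <= N)%N -> iid_data (F N) (mu N)) /\
     Omega1 (fun N => err_iid (M N) (xtilde N) (F N) (mu N))).
Proof.
split.
- have hard N : exists Fx : (datum R -> R) * N.-tuple (datum R), (2 <= N)%N ->
      fixed_data Fx.1 Fx.2 /\
      ((1 + expR eps)^-1%:E <= err_fixed (M N) (xtilde N) Fx.1 Fx.2)%E.
    have [N2|N2] := leqP 2 N; last by exists (cst 0, [tuple of nseq N point]).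
    case: N N2 (M N) (xtilde N) (M_private N) => // n n2 Mn est Mn_private.
    have [F [x Fx]] := exists_hard_fixed_data est (Mn_private n2) n2.
    by exists (F, x).
  pose Fx N := sval (boolp.cid (hard N)).
  have hFx N := svalP (boolp.cid (hard N)).
  exists (fun N => (Fx N).1), (fun N => (Fx N).2).
  split; first by move=> N /hFx[].
  exists (1 + expR eps)^-1; first by rewrite invr_gt0 addr_gt0 ?expR_gt0.
  by exists 2%N => N /hFx[].
- have hard N : exists Fmu : (datum R -> R) * probability (datum R) R,
      (2 <= N)%N -> iid_data Fmu.1 Fmu.2 /\
      (4^-1%:E <= err_iid (M N) (xtilde N) Fmu.1 Fmu.2)%E.
    have [N0|N0] := posnP N.
      by exists (cst 0, \d_(point : datum R) : probability (datum R) R); rewrite N0.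
    have [F [mu Fmu]] := exists_hard_iid_data (M N) (xtilde N) N0.
    by exists (F, mu).
  have [Fmu hFmu] := choice hard.
  exists (fun N => (Fmu N).1), (fun N => (Fmu N).2).
  split; first by move=> N /hFmu[].
  exists 4^-1; first by rewrite invr_gt0.
  by exists 2%N => N /hFmu[].
Qed.
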